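(* Let $K\subseteq\mathbf{R}^n$ be a nonempty unbounded closed set and let $f=(f_1,\dots,f_q):\mathbf{R}^n\to\mathbf{R}^q$ be a vector polynomial with $\deg f_i=d_i\ge1$, $\mathbf d=(d_1,\dots,d_q)$. Assume there exist $\bar x\in K$ and a nonempty index set $I\subseteq\{1,\dots,q\}$ such that $f$ is $I$-section-bounded from below at $\bar x$. Then the following conditions are equivalent, and if one of them holds then the problem of minimizing $f$ over $K$ admits at least one Pareto efficient solution, i.e. $SOL^{s}(K,f)\neq\emptyset$: (i) $f$ is relatively $I$-$\mathbf{R}^q_+$-zero-regular with $K_{\bar x}$ on $K$; (ii) $f$ is relatively strongly regular with $K_{\bar x}$ on $K$; (iii) $f|_K$ is $I$-proper at the sublevel $f(\bar x)$; (iv) $f|_K$ satisfies the $I$-Palais-Smale condition at the sublevel $f(\bar x)$; (v) $f|_K$ satisfies the weak $I$-Palais-Smale condition at the sublevel $f(\bar x)$; (vi) $f|_K$ satisfies the $I$-M-tame condition at the sublevel $f(\bar x)$. In particular, if $I=\{1,\dots,q\}$ and $f$ is relatively weakly regular with $K_{\bar x}$ on $K$, then $SOL^{s}(K,f)$ is also nonempty.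
   Context: $\mathbf{R}^q_+$ is the nonnegative orthant; $y\le z$ means $z-y\in\mathbf{R}^q_+$. $K_{\bar x}=\{x\in K: f(x)\le f(\bar x)\}$. Asymptotic cone: $S_\infty=\{v:\exists\, t_k\to+\infty,\ x_k\in S,\ x_k/t_k\to v\}$. For a polynomial $p$ of degree $d$, $p^\infty_d(x)=\lim_{t\to+\infty}p(tx)/t^d$; $f^\infty_{\mathbf d}=((f_1)^\infty_{d_1},\dots,(f_q)^\infty_{d_q})$. $SOL(A,p)$: global minimizers of the scalar function $p$ over $A$. $SOL^{s}(A,g)=\{x^*\in A: g(x)-g(x^* )\notin-\mathbf{R}^q_+\setminus\{0\}\ \forall x\in A\}$, $SOL^{w}(A,g)=\{x^*\in A: g(x)-g(x^* )\notin-\operatorname{int}\mathbf{R}^q_+\ \forall x\in A\}$. $f$ is $I$-section-bounded from below at $\bar x$ if $f_i$ is bounded from below on $K_{\bar x}$ for every $i\in I$. Relative regularity: let $S$ be a nonempty closed set such that $(K_{\bar x})_\infty\subseteq S_\infty\subseteq K_\infty$ for some $\bar x\in K$. With $S$ on $K$, $f$ is: relatively $I$-$\mathbf{R}^q_+$-zero-regular if there is $\lambda\in\mathbf{R}^q_+\setminus\{0\}$ with $\{i:\lambda_i\ne0\}=I$ such that $SOL(S_\infty,\{\sum_i\lambda_i f_i\}^\infty_d)$, $d=\deg\sum_i\lambda_i f_i$, is bounded; relatively weakly regular if $SOL^{s}(S_\infty,f^\infty_{\mathbf d})$ is bounded; relatively strongly regular if $SOL^{w}(S_\infty,f^\infty_{\mathbf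 d})$ is bounded. (The empty set is bounded.) For $I=\{s_1,\dots,s_p\}$, $f_I=(f_{s_1},\dots,f_{s_p})$. $f|_K$ is $I$-proper at the sublevel $\bar y\in\mathbf{R}^q$ if for every $\{x_k\}\subseteq K$ with $\|x_k\|\to+\infty$ and $f(x_k)\le\bar y$, one has $\|f_I(x_k)\|\to+\infty$. Let $N(x;K)$ be the limiting (Mordukhovich) normal cone to $K$ at $x$. The extended Rabier function is $\nu(x)=\inf\{\|\sum_{i=1}^q\alpha_i\nabla f_i(x)+\omega\| : \omega\in N(x;K),\ \alpha\in\mathbf{R}^q_+,\ \sum_{i=1}^q\alpha_i=1\}$. The tangency variety is $\Gamma(f,K)=\{x\in K:\exists(\alpha,\mu)\in\mathbf{R}^q_+\times\mathbf{R},\ \sum_{i=1}^q\alpha_i+|\mu|=1,\ 0\in\sum_{i=1}^q\alpha_i\nabla f_i(x)+\mu x+N(x;K)\}$. For $y_0\in(\mathbf{R}\cup\{\infty\})^q$ define $\widetilde K^I_{\infty,\le y_0}(f,K)=\{y\in\mathbf{R}^{|I|}:\exists\{x_k\}\subseteq K,\ f(x_k)\le y_0,\ \|x_k\|\to+\infty,\ f_I(x_k)\to y,\ \nu(x_k)\to0\}$; $K^I_{\infty,\le y_0}(f,K)=\{y\in\mathbf{R}^{|I|}:\exists\{x_k\}\subseteq K,\ f(x_k)\le y_0,\ \|x_k\|\to+\infty,\ f_I(x_k)\to y,\ \|x_k\|\nu(x_k)\to0\}$; $T^I_{\infty,\le y_0}(f,K)=\{y\in\mathbf{R}^{|I|}:\exists\{x_k\}\subseteq\Gamma(f,K),\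 f(x_k)\le y_0,\ \|x_k\|\to+\infty,\ f_I(x_k)\to y\}$. $f|_K$ satisfies, at the sublevel $y_0$, the $I$-Palais-Smale condition if $\widetilde K^I_{\infty,\le y_0}(f,K)=\emptyset$; the weak $I$-Palais-Smale condition if $K^I_{\infty,\le y_0}(f,K)=\emptyset$; the $I$-M-tame condition if $T^I_{\infty,\le y_0}(f,K)=\emptyset$. *)

(* Defs.v *)
(* [mpoly] is not imported because its notations
   clash with those of MathComp-Analysis; [mpoly.mpoly n R] is {mpoly R[n]}. *)
From HB Require Import structures.
From mathcomp Require Export all_boot all_order all_algebra.
From mathcomp Require Export all_classical all_reals all_analysis.
From mathcomp Require mpoly.
Export (canonicals, coercions) mpoly.
Export Order.TTheory GRing.Theory Num.Theory.
Export numFieldNormedType.Exports.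

Set Implicit Arguments.
Unset Strict Implicit.
Unset Printing Implicit Defensive.

Local Open Scope classical_set_scope.
Local Open Scope ring_scope.

Section Euclidean.
Context {R : realType}.

Definition dotv {n : nat} (u v : 'rV[R]_n) : R := \sum_(i < n) u 0 i * v 0 i.

(* The library norm [`|x|] on row vectors is the sup norm; topology and
   boundedness are insensitive to this choice, so [bounded_set] is kept. *)
Definition enorm {n : nat} (x : 'rV[R]_n) : R := Num.sqrt (dotv x x).

Definition orthant {q : nat} : set 'rV[R]_q := [set y | forall i, 0 <= y 0 i].

Definition vle {q : nat} (y z : 'rV[R]_q) : Prop := orthant (z - y).

(* The level [y0] is meant in (R u {+oo})^q; [-oo] entries only yield empty sets. *)
Definition vle_ext {q : nat} (y : 'rV[R]_q) (y0 : 'I_q -> \bar R) : Prop :=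
  forall i, ((y 0 i)%:E <= y0 i)%E.

Definition ext_level {q : nat} (y : 'rV[R]_q) : 'I_q -> \bar R :=
  fun i => (y 0 i)%:E.

Definition asym_cone {n : nat} (S : set 'rV[R]_n) : set 'rV[R]_n :=
  [set v | exists (t : nat -> R) (x : nat -> 'rV[R]_n),
     [/\ t k @[k --> \oo] --> +oo, forall k, S (x k)
       & (t k)^-1 *: x k @[k --> \oo] --> v]].

(* Regular (Frechet) normals:
   limsup <v, y - x> / ||y - x|| <= 0 as y -> x within K. *)
Definition regular_normal {n : nat} (K : set 'rV[R]_n) (x : 'rV[R]_n) :
    set 'rV[R]_n :=
  [set v | forall e : R, 0 < e ->
     \forall y \near x, K y -> dotv v (y - x) <= e * enorm (y - x)].

(* Limiting (Mordukhovich) normals; empty when [x] is not in the closure of K. *)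
Definition normal_cone {n : nat} (K : set 'rV[R]_n) (x : 'rV[R]_n) :
    set 'rV[R]_n :=
  [set v | exists (z w : nat -> 'rV[R]_n),
     [/\ forall k, K (z k), z k @[k --> \oo] --> x,
         forall k, regular_normal K (z k) (w k)
       & w k @[k --> \oo] --> v]].

End Euclidean.

Section Polynomials.
Context {R : realType} {n : nat}.
Implicit Type p : mpoly.mpoly n R.

Definition peval p (x : 'rV[R]_n) : R := mpoly.meval (fun i => x 0 i) p.

(* [msize] is 1 + total degree, and 0 for the zero polynomial, which is thus
   given degree 0. *)
Definition pdeg p : nat := (mpoly.msize p).-1.

Definition grad p (x : 'rV[R]_n) : 'rV[R]_n :=
  \row_(j < n) peval (mpoly.mderiv j p) x.

Definition asym_poly p (x : 'rV[R]_n) : R :=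
  lim (peval p (t *: x) / t ^+ pdeg p @[t --> +oo]).

End Polynomials.

Section Solutions.
Context {R : realType} {n : nat}.

Definition SOL (A : set 'rV[R]_n) (p : 'rV[R]_n -> R) : set 'rV[R]_n :=
  [set xs | A xs /\ forall x, A x -> p xs <= p x].

Definition SOLs {q : nat} (A : set 'rV[R]_n) (g : 'rV[R]_n -> 'rV[R]_q) :
    set 'rV[R]_n :=
  [set xs | A xs /\ forall x, A x ->
     ~ [set - c | c in orthant `\ 0] (g x - g xs)].

Definition SOLw {q : nat} (A : set 'rV[R]_n) (g : 'rV[R]_n -> 'rV[R]_q) :
    set 'rV[R]_n :=
  [set xs | A xs /\ forall x, A x ->
     ~ [set - c | c in interior orthant] (g x - g xs)].

End Solutions.

Section VectorPolynomial.
Context {R : realType} {n q : nat}.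
Implicit Types (K S A : set 'rV[R]_n) (I : {set 'I_q}) (x xbar : 'rV[R]_n).
Variable f : 'I_q -> mpoly.mpoly n R.

Definition vval x : 'rV[R]_q := \row_(i < q) peval (f i) x.

(* [enum_val] lists the elements of I in increasing order. *)
Definition vval_on I x : 'rV[R]_#|I| :=
  \row_(j < #|I|) peval (f (enum_val j)) x.

Definition asym_vec x : 'rV[R]_q := \row_(i < q) asym_poly (f i) x.

Definition section K xbar : set 'rV[R]_n :=
  [set x | K x /\ vle (vval x) (vval xbar)].

Definition section_bounded_below K I xbar : Prop :=
  forall i, i \in I -> has_lbound [set peval (f i) x | x in section K xbar].

Definition admissible K S : Prop :=
  [/\ S !=set0, closed S
    & exists2 xbar, K xbar &
        asym_cone (section K xbar) `<=` asym_cone S /\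
        asym_cone S `<=` asym_cone K].

Definition rel_zero_regular K S I : Prop :=
  admissible K S /\
  exists lam : 'rV[R]_q,
    [/\ orthant lam, lam != 0, [set i | lam 0 i != 0]%SET = I
      & bounded_set
          (SOL (asym_cone S) (asym_poly (\sum_(i < q) lam 0 i *: f i)))].

Definition rel_weakly_regular K S : Prop :=
  admissible K S /\ bounded_set (SOLs (asym_cone S) asym_vec).

Definition rel_strongly_regular K S : Prop :=
  admissible K S /\ bounded_set (SOLw (asym_cone S) asym_vec).

Definition proper_at K I (ybar : 'rV[R]_q) : Prop :=
  forall x : nat -> 'rV[R]_n,
    (forall k, K (x k)) -> enorm (x k) @[k --> \oo] --> +oo ->
    (forall k, vle (vval (x k)) ybar) ->
    enorm (vval_on I (x k)) @[k --> \oo] --> +oo.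

Definition rabier K x : R :=
  inf [set r | exists (a : 'rV[R]_q) (w : 'rV[R]_n),
    [/\ orthant a, \sum_(i < q) a 0 i = 1, normal_cone K x w
      & r = enorm (\sum_(i < q) a 0 i *: grad (f i) x + w)]].

Definition tangency_variety K : set 'rV[R]_n :=
  [set x | K x /\ exists (a : 'rV[R]_q) (mu : R),
    [/\ orthant a, \sum_(i < q) a 0 i + `|mu| = 1
      & exists2 w, normal_cone K x w &
          0 = \sum_(i < q) a 0 i *: grad (f i) x + mu *: x + w]].

Definition escaping A (y0 : 'I_q -> \bar R) I
    (x : nat -> 'rV[R]_n) (y : 'rV[R]_#|I|) : Prop :=
  [/\ forall k, A (x k), forall k, vle_ext (vval (x k)) y0,
      enorm (x k) @[k --> \oo] --> +oo
    & vval_on I (x k) @[k --> \oo] --> y].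

Definition PS_values K y0 I : set 'rV[R]_#|I| :=
  [set y | exists x : nat -> 'rV[R]_n,
     escaping K y0 x y /\ rabier K (x k) @[k --> \oo] --> (0 : R)].

Definition weak_PS_values K y0 I : set 'rV[R]_#|I| :=
  [set y | exists x : nat -> 'rV[R]_n,
     escaping K y0 x y /\
     enorm (x k) * rabier K (x k) @[k --> \oo] --> (0 : R)].

Definition tangency_values K y0 I : set 'rV[R]_#|I| :=
  [set y | exists x : nat -> 'rV[R]_n, escaping (tangency_variety K) y0 x y].

Definition palais_smale K I y0 : Prop := PS_values K y0 (I := I) = set0.

Definition weak_palais_smale K I y0 : Prop := weak_PS_values K y0 (I := I) = set0.

Definition M_tame K I y0 : Prop := tangency_values K y0 (I := I) = set0.

End VectorPolynomial.

(* Main.v *)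
Require Import Defs.
From mathcomp Require Import all_boot all_order all_algebra.
From mathcomp Require Import all_classical all_reals all_analysis.
From mathcomp Require Import ring lra.
Import Order.TTheory GRing.Theory Num.Theory.

(** Write [Kx] for the section of [K] at [xbar]. Each of the six conditions is
    equivalent to the boundedness of [Kx], and a bounded section is compact, so that
    minimising the sum of the objectives over it gives a Pareto efficient point
    ([pareto_of_bounded]).

    What links the conditions is that [f_I] is bounded on [Kx]: above by its value
    at [xbar], below by hypothesis. For properness the equivalence is then immediate
    ([proper_iff]). For the regularity conditions it is a statement on the asymptotic
    cone, which is bounded exactly when [Kx] is ([bounded_asym_cone]). A polynomial
    bounded on [Kx] has a constant asymptotic polynomial on the cone, equal to 0 in
    positive degree ([asym_poly_bounded]); hence all points of the cone solve the
    asymptotic problems, and their solution sets are bounded only if the cone is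
    ([zero_regular_iff], [strongly_regular_iff]; [bounded_of_weakly_regular] when [I]
    is the full index set).

    If [Kx] is bounded, no sequence of [Kx] goes to infinity and the Palais-Smale and
    tameness conditions hold vacuously. Conversely, an unbounded [Kx] contains bad
    sequences, found by minimising an objective [f i0] with [i0] in [I]:
    [small_rabier_at_infinity] adds a small quadratic perturbation around a point
    that is almost minimal at infinity, and finds points far out where the norm
    times the Rabier function is arbitrarily small; [tangency_at_infinity] minimises
    over the intersection of [Kx] with large spheres, and finds points of the
    tangency variety. The values of [f_I] stay in a compact set, so these points
    yield asymptotic values ([escaping_subseq]).

    Both constructions rest on the Fritz John multiplier rule for polynomial
    constraints on an arbitrary closed set, with limiting normals ([fritz_john]).
    The multipliers of the section constraints only join the convex combination of
    the gradients of the objectives, which is why the residual normal vector is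
    normal to [K] itself. *)

Set Implicit Arguments.
Unset Strict Implicit.
Unset Printing Implicit Defensive.

Local Open Scope classical_set_scope.
Local Open Scope ring_scope.

(** * Limits and Euclidean geometry of row vectors *)

Lemma cvg_sum_fin (V : TopologicalNmodule.type) (T J : Type)
    (F : set_system T) {FF : Filter F} (r : seq J) (P : pred J)
    (g : J -> T -> V) (l : J -> V) :
  (forall j, P j -> g j t @[t --> F] --> l j) ->
  \sum_(j <- r | P j) g j t @[t --> F] --> \sum_(j <- r | P j) l j.
Proof. by move=> gl; apply: cvg_big => //; exact: add_continuous. Qed.

Lemma cvg_prod_fin (R : realType) (T J : Type)
    (F : set_system T) {FF : Filter F} (r : seq J) (P : pred J)
    (g : J -> T -> R) (l : J -> R) :
  (forall j, P j -> g j t @[t --> F] --> l j) ->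
  \prod_(j <- r | P j) g j t @[t --> F] --> \prod_(j <- r | P j) l j.
Proof. by move=> gl; apply: cvg_big => //; exact: mul_continuous. Qed.

Lemma cvg_exprn (R : realType) (T : Type) (F : set_system T) {FF : Filter F}
    (g : T -> R) (l : R) (m : nat) :
  g t @[t --> F] --> l -> g t ^+ m @[t --> F] --> l ^+ m.
Proof.
move=> gl; elim: m => [|m IHm]; first by rewrite expr0; exact: cvg_cst.
by under eq_cvg do rewrite exprS; rewrite exprS; exact: cvgM.
Qed.

Section RowVectors.
Context {R : realType} {n : nat}.
Implicit Types (x y u v w : 'rV[R]_n) (c : R).

Lemma cvg_coord (T : Type) (F : set_system T) {FF : Filter F}
    (u : T -> 'rV[R]_n) v (i : 'I_n) :
  u t @[t --> F] --> v -> u t 0 i @[t --> F] --> v 0 i.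
Proof.
move=> uv; apply: (cvg_comp u (fun M : 'rV[R]_n => M 0 i) uv).
exact: coord_continuous.
Qed.

Lemma cvg_rV (T : Type) (F : set_system T) {FF : Filter F}
    (u : T -> 'rV[R]_n) v :
  (forall i, u t 0 i @[t --> F] --> v 0 i) -> u t @[t --> F] --> v.
Proof.
move=> uv; under eq_cvg do rewrite [u _]row_sum_delta.
rewrite [v]row_sum_delta; apply: cvg_sum_fin => i _.
by apply: cvgZr_tmp; exact: uv.
Qed.

Lemma dotvC u v : dotv u v = dotv v u.
Proof. by apply: eq_bigr => i _; rewrite mulrC. Qed.

Lemma dotvDl u v w : dotv (u + v) w = dotv u w + dotv v w.
Proof.
by rewrite /dotv -big_split /=; apply: eq_bigr => i _; rewrite mxE mulrDl.
Qed.

Lemma dotvZl c u w : dotv (c *: u) w = c * dotv u w.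
Proof.
by rewrite /dotv mulr_sumr; apply: eq_bigr => i _; rewrite mxE mulrA.
Qed.

Lemma dot0v w : dotv 0 w = 0.
Proof. by rewrite -(scale0r (0 : 'rV_n)) dotvZl mul0r. Qed.

Lemma dotvDr w u v : dotv w (u + v) = dotv w u + dotv w v.
Proof. by rewrite dotvC dotvDl !(dotvC w). Qed.

Lemma dotvZr c w u : dotv w (c *: u) = c * dotv w u.
Proof. by rewrite dotvC dotvZl (dotvC w). Qed.

Lemma dotvNl u w : dotv (- u) w = - dotv u w.
Proof. by rewrite -scaleN1r dotvZl mulN1r. Qed.

Lemma dotvNr w u : dotv w (- u) = - dotv w u.
Proof. by rewrite dotvC dotvNl dotvC. Qed.

Lemma dotv_ge0 u : 0 <= dotv u u.
Proof. by apply: sumr_ge0 => i _; rewrite -expr2 sqr_ge0. Qed.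

Lemma enorm_ge0 u : 0 <= enorm u.
Proof. exact: sqrtr_ge0. Qed.

Lemma enorm_sqr u : enorm u ^+ 2 = dotv u u.
Proof. by rewrite sqr_sqrtr ?dotv_ge0. Qed.

Lemma enormZ c u : enorm (c *: u) = `|c| * enorm u.
Proof.
by rewrite /enorm dotvZl dotvZr mulrA -expr2 sqrtrM ?sqr_ge0// sqrtr_sqr.
Qed.

Lemma enormN u : enorm (- u) = enorm u.
Proof. by rewrite -scaleN1r enormZ normrN normr1 mul1r. Qed.

Lemma coord_le_enorm u (i : 'I_n) : `|u 0 i| <= enorm u.
Proof.
rewrite -(@ler_pXn2r _ 2) ?nnegrE ?enorm_ge0// enorm_sqr real_normK ?num_real//.
rewrite /dotv (bigD1 i)//= -expr2 lerDl.
by apply: sumr_ge0 => j _; rewrite -expr2 sqr_ge0.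
Qed.

Lemma coord_le_norm u (i : 'I_n) : `|u 0 i| <= `|u|.
Proof.
by rewrite [leRHS]/Num.Def.normr /= mx_normrE; apply: (le_bigmax _ _ (0, i)).
Qed.

Lemma norm_le_coords u c :
  0 <= c -> (forall i, `|u 0 i| <= c) -> `|u| <= c.
Proof.
move=> c0 uc; rewrite [leLHS]/Num.Def.normr /= mx_normrE.
by apply/bigmax_leP; split=> // -[i j] _ /=; rewrite ord1.
Qed.

Lemma norm_le_enorm u : `|u| <= enorm u.
Proof. by apply: norm_le_coords; [exact: enorm_ge0|exact: coord_le_enorm]. Qed.

Lemma enorm_le_norm u : enorm u <= n%:R * `|u|.
Proof.
rewrite -(@ler_pXn2r _ 2) ?nnegrE ?enorm_ge0 ?mulr_ge0// enorm_sqr exprMn.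
apply: (@le_trans _ _ (n%:R * `|u| ^+ 2)).
  rewrite mulr_natl -[X in _ *+ X](card_ord n) -sumr_const.
  apply: ler_sum => i _; rewrite -expr2 -real_normK ?num_real//.
  by rewrite ler_pXn2r ?nnegrE// coord_le_norm.
rewrite ler_wpM2r ?sqr_ge0// -natrX ler_nat.
by case: (n) => // k; exact: leq_pmulr.
Qed.

Lemma dotv_le u v : dotv u v <= (\sum_(i < n) `|u 0 i|) * enorm v.
Proof.
rewrite mulr_suml; apply: ler_sum => i _; apply: (le_trans (ler_norm _)).
by rewrite normrM ler_wpM2l// coord_le_enorm.
Qed.

Lemma dotv_eq0 u : dotv u u = 0 -> u = 0.
Proof.
move=> u0; apply/eqP; rewrite -normr_eq0 eq_le normr_ge0 andbT.
by rewrite (le_trans (norm_le_enorm u))// /enorm u0 sqrtr0.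
Qed.

(** This consequence of the parallelogram law stands in for the triangle
    inequality of [enorm]. *)
Lemma dotv_sub_le u v : dotv u u <= 2 * dotv v v + 2 * dotv (u - v) (u - v).
Proof.
have := dotv_ge0 (u - 2 *: v).
rewrite !(dotvDl, dotvDr, dotvNl, dotvNr, dotvZl, dotvZr) (dotvC v u); lra.
Qed.

Lemma cvg_dotv (T : Type) (F : set_system T) {FF : Filter F}
    (g h : T -> 'rV[R]_n) u v :
  g t @[t --> F] --> u -> h t @[t --> F] --> v ->
  dotv (g t) (h t) @[t --> F] --> dotv u v.
Proof.
move=> gu hv; apply: (@cvg_sum_fin R _ _ F FF _ _
  (fun i t => g t 0 i * h t 0 i) (fun i => u 0 i * v 0 i)) => i _.
by apply: cvgM; exact: cvg_coord.
Qed.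

End RowVectors.

(** * Polynomial functions and their gradients *)

Section PolynomialFunctions.
Context {R : realType} {n : nat}.
Implicit Types (p r : mpoly.mpoly n R) (x y c : 'rV[R]_n) (a : R).

Lemma pevalD p r x : peval (p + r) x = peval p x + peval r x.
Proof. exact: mpoly.mevalD. Qed.

Lemma pevalB p r x : peval (p - r) x = peval p x - peval r x.
Proof. exact: mpoly.mevalB. Qed.

Lemma pevalM p r x : peval (p * r) x = peval p x * peval r x.
Proof. exact: mpoly.mevalM. Qed.

Lemma pevalZ a p x : peval (a *: p) x = a * peval p x.
Proof. exact: mpoly.mevalZ. Qed.

Lemma pevalC a x : peval (mpoly.mpolyC n a) x = a.
Proof. exact: mpoly.mevalC. Qed.

Lemma pevalX (i : 'I_n) x : peval (mpoly.mpolyX R (mpoly.mnm1 i)) x = x 0 i.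
Proof. exact: mpoly.mevalXU. Qed.

Lemma peval_sum (J : Type) (s : seq J) (P : pred J)
    (g : J -> mpoly.mpoly n R) x :
  peval (\sum_(j <- s | P j) g j) x = \sum_(j <- s | P j) peval (g j) x.
Proof.
by elim/big_rec2 : _ => [|j b c _ <-]; rewrite ?pevalD//; exact: mpoly.meval0.
Qed.

Lemma gradD p r x : grad (p + r) x = grad p x + grad r x.
Proof. by apply/rowP => i; rewrite !mxE mpoly.mderivD pevalD. Qed.

Lemma gradZ a p x : grad (a *: p) x = a *: grad p x.
Proof. by apply/rowP => i; rewrite !mxE mpoly.mderivZ pevalZ. Qed.

Lemma gradM p r x :
  grad (p * r) x = peval r x *: grad p x + peval p x *: grad r x.
Proof.
by apply/rowP => i; rewrite !mxE mpoly.mderivM pevalD !pevalM [X in X + _]mulrC.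
Qed.

Lemma gradC a x : grad (mpoly.mpolyC n a) x = 0.
Proof. by apply/rowP => i; rewrite !mxE mpoly.mderivC; exact: mpoly.meval0. Qed.

Lemma gradB p r x : grad (p - r) x = grad p x - grad r x.
Proof. by rewrite gradD -[- r]scaleN1r gradZ scaleN1r. Qed.

Lemma gradX (i : 'I_n) x : grad (mpoly.mpolyX R (mpoly.mnm1 i)) x = delta_mx 0 i.
Proof.
apply/rowP => j; rewrite !mxE mpoly.mderivX pevalZ mpoly.mnm1E [i == j]eq_sym /=.
case: eqP => [->|_]; rewrite ?mul0r// mul1r.
have -> : mpoly.mnm_sub (mpoly.mnm1 i) (mpoly.mnm1 i) = @mpoly.mnm0 n.
  by apply/mpoly.mnmP => k; rewrite mpoly.mnmBE subnn mpoly.mnm0E.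
by rewrite mpoly.mpolyX0; exact: mpoly.meval1.
Qed.

Lemma grad_sum (J : Type) (s : seq J) (P : pred J)
    (g : J -> mpoly.mpoly n R) x :
  grad (\sum_(j <- s | P j) g j) x = \sum_(j <- s | P j) grad (g j) x.
Proof.
elim/big_rec2 : _ => [|j b c _ <-]; last by rewrite gradD.
by rewrite -mpoly.mpolyC0 gradC.
Qed.

Lemma mpoly_ring_ind (P : mpoly.mpoly n R -> Prop) :
  (forall a, P (mpoly.mpolyC n a)) ->
  (forall i, P (mpoly.mpolyX R (mpoly.mnm1 i))) ->
  (forall p r, P p -> P r -> P (p + r)) ->
  (forall p r, P p -> P r -> P (p * r)) -> forall p, P p.
Proof.
move=> PC PX PD PM; elim/mpoly.mpolyind => [|a m p _ _ Pp].
  by rewrite -mpoly.mpolyC0.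
apply: PD => //; rewrite -mpoly.mul_mpolyC; apply: (PM) => //.
rewrite mpoly.mpolyXE_id; apply: (big_ind P) => [|x y|i _]; [|exact: (PM)|].
  by rewrite -mpoly.mpolyC1.
elim: (m i) => [|k IHk]; first by rewrite expr0 -mpoly.mpolyC1.
by rewrite exprS; exact: PM.
Qed.

Lemma peval_continuous p : continuous (peval p).
Proof.
elim/mpoly_ring_ind : p => [a|i|p r cp cr|p r cp cr] x.
- rewrite (_ : peval _ = cst a); first exact: cst_continuous.
  by apply/funext => y; exact: pevalC.
- rewrite (_ : peval _ = fun y : 'rV[R]_n => y 0 i); first exact: coord_continuous.
  by apply/funext => y; exact: pevalX.
- rewrite (_ : peval _ = fun y => peval p y + peval r y); last first.
    by apply/funext => y; exact: pevalD.
  exact: (cvgD (cp x) (cr x)).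
- rewrite (_ : peval _ = fun y => peval p y * peval r y); last first.
    by apply/funext => y; exact: pevalM.
  exact: (cvgM (cp x) (cr x)).
Qed.

Lemma cvg_peval (T : Type) (F : set_system T) {FF : Filter F}
    (u : T -> 'rV[R]_n) x p :
  u t @[t --> F] --> x -> peval p (u t) @[t --> F] --> peval p x.
Proof.
by move=> ux; exact: (cvg_comp u (peval p) ux (@peval_continuous p x)).
Qed.

Lemma cvg_grad (T : Type) (F : set_system T) {FF : Filter F}
    (u : T -> 'rV[R]_n) x p :
  u t @[t --> F] --> x -> grad p (u t) @[t --> F] --> grad p x.
Proof.
move=> ux; apply: cvg_rV => i; rewrite mxE.
by under eq_cvg do rewrite mxE; exact: cvg_peval.
Qed.

(** Differentiability in Carathéodory's form. Slopes of sums and products are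
    explicit combinations of slopes, so no remainder has to be estimated. *)
Lemma peval_slope p x : exists D : 'rV[R]_n -> 'rV[R]_n,
  [/\ D y @[y --> x] --> D x, D x = grad p x
    & forall y, peval p y - peval p x = dotv (D y) (y - x)].
Proof.
elim/mpoly_ring_ind : p => [a|i|p r|p r].
- exists (fun=> 0); rewrite gradC; split=> [|//|y]; first exact: cst_continuous.
  by rewrite !pevalC subrr dot0v.
- exists (fun=> delta_mx 0 i); rewrite gradX; split=> [|//|y].
    exact: cst_continuous.
  rewrite !pevalX /dotv (bigD1 i)//= big1 => [|j ji].
    by rewrite !mxE !eqxx mul1r addr0.
  by rewrite !mxE (negbTE ji) andbF mul0r.
- move=> [D [Dc Dx Dp]] [E [Ec Ex Er]]; exists (fun y => D y + E y).
  rewrite gradD -Dx -Ex; split=> [|//|y]; first exact: (cvgD Dc Ec).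
  by rewrite !pevalD opprD addrACA Dp Er dotvDl.
- move=> [D [Dc Dx Dp]] [E [Ec Ex Er]].
  exists (fun y => peval r y *: D y + peval p x *: E y).
  rewrite gradM -Dx -Ex; split=> [|//|y].
    exact: (cvgD (cvgZ (@peval_continuous r x) Dc)
                 (cvgZ (cvg_cst (peval p x)) Ec)).
  by rewrite !pevalM dotvDl !dotvZl -Dp -Er; ring.
Qed.

(** The factor [1/2] makes the gradient exactly [x - c], which is the vector that
    multiplies [mu] in the definition of the tangency variety when [c = 0]. *)
Definition half_sqdist c : mpoly.mpoly n R :=
  \sum_(i < n) 2^-1 *: ((mpoly.mpolyX R (mpoly.mnm1 i) - mpoly.mpolyC n (c 0 i))
                      * (mpoly.mpolyX R (mpoly.mnm1 i) - mpoly.mpolyC n (c 0 i))).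

Lemma peval_half_sqdist c x : peval (half_sqdist c) x = 2^-1 * dotv (x - c) (x - c).
Proof.
rewrite peval_sum mulr_sumr; apply: eq_bigr => i _.
by rewrite pevalZ pevalM !pevalB pevalX pevalC !mxE.
Qed.

Lemma grad_half_sqdist c x : grad (half_sqdist c) x = x - c.
Proof.
rewrite grad_sum [RHS]row_sum_delta; apply: eq_bigr => i _.
rewrite gradZ gradM !gradB gradX gradC !pevalB pevalX pevalC subr0 -scalerDl scalerA.
by rewrite !mxE; congr (_ *: _); field.
Qed.

End PolynomialFunctions.

(** * Subsequences, normal cones and penalties *)

Lemma cvg_subseq_infty (phi : nat -> nat) :
  (forall k, (k <= phi k)%N) -> phi k @[k --> \oo] --> \oo.
Proof.
move=> phi_ge; apply/cvgnyPge => N; exists N => // k /= Nk.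
exact: leq_trans Nk (phi_ge k).
Qed.

Lemma cvg_of_harmonic (R : realType) (T : pseudoMetricType R) (u : nat -> T) l :
  (forall k, ball l k.+1%:R^-1 (u k)) -> u k @[k --> \oo] --> l.
Proof.
move=> ul; apply/cvg_ballP => e e0; near=> k.
apply: le_ball (ul k); near: k.
by have := near_infty_natSinv_lt (PosNum e0); apply: filterS => k /ltW.
Unshelve. all: by end_near. Qed.

(** Of the selection [phi] only [k <= phi k] is recorded: it is all that limits
    along [phi] require. *)
Lemma compact_subseq (R : realType) (T : pseudoMetricType R) (C : set T)
    (u : nat -> T) :
  compact C -> (forall k, C (u k)) ->
  exists (phi : nat -> nat) (l : T),
    [/\ C l, forall k, (k <= phi k)%N & u (phi k) @[k --> \oo] --> l].
Proof.
move=> Cc Cu; have FC : (u x @[x --> \oo]) C by exists 0%N => // k _; exact: Cu.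
have [l [Cl clu]] := Cc (u x @[x --> \oo]) _ FC.
have ex k : exists j, (k <= j)%N /\ ball l k.+1%:R^-1 (u j).
  have Fk : (u x @[x --> \oo]) [set u j | j in [set j | (k <= j)%N]].
    by exists k => // j /= kj; exists j.
  have k0 : 0 < k.+1%:R^-1 :> R by rewrite invr_gt0.
  have [_ [[j kj <-] bj]] := clu _ _ Fk (nbhsx_ballx l _ k0).
  by exists j.
have [phi phiP] := choice ex.
exists phi, l; split=> [//|k|]; first by have [] := phiP k.
by apply: cvg_of_harmonic => k; have [] := phiP k.
Qed.

Lemma compact_argmin (R : realType) (T : topologicalType) (A : set T) (F : T -> R) :
  A !=set0 -> compact A -> continuous F ->
  exists x, A x /\ forall y, A y -> F x <= F y.
Proof.
move=> A0 Ac /continuous_subspaceT Fc.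
have [x xA xmin] := compact_EVT_min A0 Ac (Fc A).
exists x; split; first by rewrite inE in xA.
by move=> y Ay; apply: xmin; rewrite inE.
Qed.

Section NormalCones.
Context {R : realType} {n : nat}.
Implicit Types (K : set 'rV[R]_n) (x w : 'rV[R]_n) (p : mpoly.mpoly n R).

Lemma compact_closed_ball K x (r : R) :
  closed K -> compact (K `&` [set y | `|x - y| <= r]).
Proof.
move=> Kc; apply: bounded_closed_compact.
  exists (`|x| + r); split=> [|M rM y [_ /= xy]]; first exact: num_real.
  apply: le_trans (ltW rM).
  have : `|y| <= `|x| + `|x - y| by rewrite -{1}(subKr x y) ler_normB.
  lra.
by apply: closedI => //; exact: closed_closed_ball_.
Qed.

Lemma regular_normalZ K x w (c : R) :
  0 < c -> regular_normal K x w -> regular_normal K x (c *: w).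
Proof.
move=> c0 wN e e0; have := wN (e / c) (divr_gt0 e0 c0).
apply: filterS => y wy Ky; rewrite dotvZl mulrC -ler_pdivlMr//.
by rewrite mulrAC; exact: wy.
Qed.

Lemma normal_cone_lim K x w (z v : nat -> 'rV[R]_n) :
  (\forall k \near \oo, K (z k) /\ regular_normal K (z k) (v k)) ->
  z k @[k --> \oo] --> x -> v k @[k --> \oo] --> w -> normal_cone K x w.
Proof.
move=> [N _ zvN] zx vw.
have shift : (k + N)%N @[k --> \oo] --> \oo.
  by apply: cvg_subseq_infty => k; exact: leq_addr.
exists (fun k => z (k + N)%N), (fun k => v (k + N)%N); split.
- by move=> k; have [] := zvN (k + N)%N (leq_addl _ _).
- exact: (cvg_comp _ _ shift zx).
- by move=> k; have [] := zvN (k + N)%N (leq_addl _ _).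
- exact: (cvg_comp _ _ shift vw).
Qed.

(** Fermat's rule relative to [K]: at a minimiser the increments of [p] within
    [K] are nonnegative, and they are [dotv (grad p x) (y - x)] up to [o(y - x)]. *)
Lemma local_min_regular_normal K p x :
  (\forall y \near x, K y -> peval p x <= peval p y) ->
  regular_normal K x (- grad p x).
Proof.
move=> xmin e e0; have [D [Dc <- Dp]] := peval_slope p x.
have d0 : 0 < e / n.+1%:R by rewrite divr_gt0.
have Dnear : \forall y \near x, `|D x - D y| < e / n.+1%:R.
  by move/cvgrPdist_lt: Dc; exact.
near=> y => Ky.
have -> : dotv (- D x) (y - x)
    = dotv (D y - D x) (y - x) - (peval p y - peval p x).
  by rewrite Dp dotvDl !dotvNl; ring.
have pxy : peval p x <= peval p y by apply: (near xmin).
apply: (@le_trans _ _ (dotv (D y - D x) (y - x))); first lra.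
apply: (le_trans (dotv_le _ _)); rewrite ler_wpM2r ?enorm_ge0//.
apply: (@le_trans _ _ (\sum_(i < n) e / n.+1%:R)).
  apply: ler_sum => i _; apply: (le_trans (coord_le_norm _ _)).
  by rewrite distrC ltW//; near: y.
rewrite sumr_const card_ord -[leLHS]mulr_natr mulrAC ler_pdivrMr// ler_wpM2l ?(ltW e0)//.
by rewrite ler_nat.
Unshelve. all: by end_near. Qed.

End NormalCones.

Section Penalty.
Context {R : realType}.
Implicit Types (a b : R) (e : bool).

(** Violation of the constraint [a = 0] (when [e]) or [a <= 0] (otherwise). It is
    signed for an equality: scaled by the penalty parameter it becomes the
    multiplier of the constraint, which may then have either sign. *)
Definition excess e a : R := if e then a else Num.max 0 a.

Lemma excess_ge0 a : 0 <= excess false a.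
Proof. by rewrite /excess le_max lexx. Qed.

(** The squared positive part lies below a parabola that touches it at [a]. So the
    squared excess of a polynomial is majorised by a polynomial that agrees with
    it at a given point, and Fermat's rule applies to the majorant. *)
Lemma excess_sqr_le e a b :
  excess e b ^+ 2 <= excess e a ^+ 2 + (2 * excess e a * (b - a) + (b - a) ^+ 2).
Proof.
rewrite /excess; case: e; first by rewrite le_eqVlt; apply/orP; left; apply/eqP; ring.
have ba := sqr_ge0 (b - a).
by have [a0|a0] := leP 0 a; have [b0|b0] := leP 0 b; nra.
Qed.

Lemma cvg_excess (T : Type) (F : set_system T) {FF : Filter F} e (g : T -> R) a :
  g t @[t --> F] --> a -> excess e (g t) @[t --> F] --> excess e a.
Proof.
move=> ga; rewrite /excess; case: e => //.
under eq_cvg do rewrite maxr_absE add0r sub0r normrN.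
rewrite maxr_absE add0r sub0r normrN.
exact: (cvgM (cvgD ga (cvg_norm ga)) (cvg_cst _)).
Qed.

End Penalty.

(** * The Fritz John multiplier rule *)

Section FritzJohn.
Context {R : realType} {n : nat} {J : finType}.
Variables (K : set 'rV[R]_n) (g : mpoly.mpoly n R).
Variables (e : pred J) (u : J -> mpoly.mpoly n R).
Implicit Types (x y : 'rV[R]_n) (s : R).

(** Constraint [j] reads [u j = 0] when [e j] holds and [u j <= 0] otherwise. *)
Definition feasible y := forall j, excess (e j) (peval (u j) y) = 0.

(** The last term makes [x] the unique minimiser of the limit problem, so that the
    minimisers of the penalised problems converge to [x] as [s] grows. *)
Definition penalized x s y : R :=
  peval g y + s / 2 * (\sum_(j : J) excess (e j) (peval (u j) y) ^+ 2)
  + 2^-1 * dotv (y - x) (y - x).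

Lemma penalized_continuous x s : continuous (penalized x s).
Proof.
move=> y; have yx : z - x @[z --> y] --> y - x.
  exact: (cvgB (@cvg_id _ (nbhs y)) (cvg_cst x)).
have pen : (\sum_(j : J) excess (e j) (peval (u j) z) ^+ 2) @[z --> y] -->
    \sum_(j : J) excess (e j) (peval (u j) y) ^+ 2.
  apply: (@cvg_sum_fin R _ _ (nbhs y) _ _ _
    (fun j z => excess (e j) (peval (u j) z) ^+ 2)) => j _.
  by apply: cvg_exprn; apply: cvg_excess; exact: peval_continuous.
exact: (cvgD (cvgD (@peval_continuous _ _ g y) (cvgM (cvg_cst (s / 2)) pen))
             (cvgM (cvg_cst (2^-1 : R)) (cvg_dotv yx yx))).
Qed.

(** Stationarity for the penalised objective: a minimiser also minimises a
    polynomial that majorises the objective and touches it there. *)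
Lemma penalized_regular_normal x s y : 0 <= s ->
  (\forall z \near y, K z -> penalized x s y <= penalized x s z) ->
  regular_normal K y
    (- (grad g y + \sum_(j : J) (s * excess (e j) (peval (u j) y)) *: grad (u j) y
        + (y - x))).
Proof.
move=> s0 ymin; pose a j := peval (u j) y; pose c j := excess (e j) (a j).
(* [M] is the majorant given by [excess_sqr_le], up to an additive constant. *)
pose M : mpoly.mpoly n R := g + \sum_(j : J) (s / 2) *:
   ((2 * c j) *: u j
    + (u j - mpoly.mpolyC n (a j)) * (u j - mpoly.mpolyC n (a j)))
   + half_sqdist x.
have -> : grad g y + \sum_(j : J) (s * c j) *: grad (u j) y + (y - x) = grad M y.
  rewrite /M !gradD grad_half_sqdist grad_sum; congr (_ + _ + _).
  apply: eq_bigr => j _.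
  rewrite gradZ gradD gradZ gradM gradB gradC pevalB pevalC subrr scale0r !addr0.
  by rewrite scalerA; congr (_ *: _); field.
apply: local_min_regular_normal; apply: filterS ymin => z yz Kz.
have := yz Kz; rewrite /penalized /M !pevalD !peval_half_sqdist !peval_sum.
set P := \sum_(j : J) _; set Q := \sum_(j : J) _.
set P' := \sum_(j : J) _; set Q' := \sum_(j : J) _.
suff PQ : s / 2 * (Q - P) <= Q' - P' by move: PQ; lra.
rewrite /P /P' /Q /Q' -!sumrB mulr_sumr; apply: ler_sum => j _.
rewrite !pevalZ !pevalD !pevalZ !pevalM !pevalB !pevalC -/(a j) -/(c j).
have := excess_sqr_le (e j) (a j) (peval (u j) z); rewrite -/(c j) => ex.
rewrite -mulrBr ler_wpM2l ?divr_ge0//; lra.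
Qed.

(** The weights of the gradients at a stationary point of the penalised problem are
    1 for the objective and [s * excess] for a constraint. As [s] grows they may
    blow up; dividing by [mass] keeps them in a compact set. *)
Definition mass s y : R := 1 + \sum_(j : J) `|s * excess (e j) (peval (u j) y)|.
Definition multiplier s y (j : J) : R :=
  (mass s y)^-1 * (s * excess (e j) (peval (u j) y)).

Lemma mass_ge1 s y : 1 <= mass s y.
Proof. by rewrite lerDl; apply: sumr_ge0. Qed.

Lemma multiplier_mass s y :
  (mass s y)^-1 + \sum_(j : J) `|multiplier s y j| = 1.
Proof.
have m0 : 0 < mass s y by exact: lt_le_trans ltr01 (mass_ge1 s y).
under eq_bigr do rewrite normrM (ger0_norm (ltW _)) ?invr_gt0//.
by rewrite -mulr_sumr -[X in X + _]mulr1 -mulrDr mulVf// gt_eqF.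
Qed.

(** The Fritz John multiplier rule with limiting normals, by McShane's penalty
    argument. The minimisers of the penalised problems are stationary with a regular
    normal, and converge to [x]; so do, along a subsequence, their multipliers
    scaled to total mass 1, and in the limit the regular normals become a limiting
    one. The normalisation allows [l = 0], as degenerate constraints force. *)
Lemma fritz_john x : closed K -> K x -> feasible x ->
  (\forall y \near x, K y -> feasible y -> peval g x <= peval g y) ->
  exists (l : R) (b : J -> R) (w : 'rV[R]_n),
    [/\ 0 <= l, forall j, ~~ e j -> 0 <= b j, l + \sum_(j : J) `|b j| = 1,
        normal_cone K x w
      & 0 = l *: grad g x + \sum_(j : J) b j *: grad (u j) x + w].
Proof.
move=> Kc Kx fx xmin.
have [r r0 rmin] : exists2 r : R, 0 < r &
    forall y, K y -> `|x - y| <= r -> feasible y -> peval g x <= peval g y.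
  have /nbhs_ballP[d d0 dmin] := xmin; exists (d / 2); first by rewrite divr_gt0.
  move=> y Ky xy; apply: dmin => //; rewrite -ball_normE /ball_ /=.
  by apply: le_lt_trans xy _; move: d0; rewrite /=; lra.
pose C := K `&` [set y | `|x - y| <= r].
have Cc : compact C by exact: compact_closed_ball.
have Cx : C x by split=> //=; rewrite subrr normr0 ltW.
have exz (k : nat) : exists z, C z /\
    forall y, C y -> penalized x k.+1%:R z <= penalized x k.+1%:R y.
  by apply: compact_argmin => //; [exists x|exact: penalized_continuous].
have [z zP] := choice exz.
have Cz k : C (z k) by have [] := zP k.
have zmin k y : C y -> penalized x k.+1%:R (z k) <= penalized x k.+1%:R y.
  by have [_] := zP k; exact.
pose B k : 'rV[R]_#|J| := \row_i multiplier k.+1%:R (z k) (enum_val i).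
pose box := [set v : 'rV[R]_#|J| | forall i, `[-1 : R, 1]%classic (v ord0 i)].
have boxc : compact box.
  apply: (@rV_compact R _ (fun=> `[-1, 1]%classic)) => i.
  exact: segment_compact.
have Bbox k : box (B k).
  move=> i; rewrite /= mxE in_itv /= -ler_norml.
  rewrite -[leRHS](multiplier_mass k.+1%:R (z k)) (bigD1 (enum_val i))//= addrCA lerDl.
  by rewrite addr_ge0 ?sumr_ge0// invr_ge0 (le_trans ler01 (mass_ge1 _ _)).
have [phi [[x' b] [[Cx' _] phi_ge lim]]] :=
  @compact_subseq R ('rV[R]_n * 'rV[R]_#|J|)%type (C `*` box) (fun k => (z k, B k))
    (compact_setX Cc boxc) (fun k => conj (Cz k) (Bbox k)).
have zx' : z (phi k) @[k --> \oo] --> x'.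
  exact: (cvg_comp _ fst lim (@cvg_fst _ _ _ _ _)).
have Bb : B (phi k) @[k --> \oo] --> b.
  exact: (cvg_comp _ snd lim (@cvg_snd _ _ _ _ _)).
pose pen y := \sum_(j : J) excess (e j) (peval (u j) y) ^+ 2.
have pen0 y : feasible y -> pen y = 0.
  by move=> fy; apply: big1 => j _; rewrite fy expr0n.
have bound k : peval g (z k) + k.+1%:R / 2 * pen (z k)
    + 2^-1 * dotv (z k - x) (z k - x) <= peval g x.
  have := zmin k x Cx; rewrite /penalized -/(pen x) -/(pen (z k)) (pen0 _ fx).
  by rewrite mulr0 addr0 subrr dot0v mulr0 addr0.
have pen_ge0 y : 0 <= pen y by apply: sumr_ge0 => j _; exact: sqr_ge0.
have gz : peval g (z (phi k)) @[k --> \oo] --> peval g x' by exact: cvg_peval.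
have penz : pen (z (phi k)) @[k --> \oo] --> pen x'.
  apply: (@cvg_sum_fin R _ _ (nbhs \oo) _ _ _
    (fun j k => excess (e j) (peval (u j) (z (phi k))) ^+ 2)) => j _.
  by apply: cvg_exprn; apply: cvg_excess; exact: cvg_peval.
have dz : z (phi k) - x @[k --> \oo] --> x' - x by exact: (cvgB zx' (cvg_cst x)).
have ddz : dotv (z (phi k) - x) (z (phi k) - x) @[k --> \oo] -->
    dotv (x' - x) (x' - x) by exact: cvg_dotv.
(* Comparison with [x] bounds [(k + 1) * pen (z k)], so the limit is feasible. *)
have pen_x' : pen x' = 0.
  apply/eqP; rewrite eq_le pen_ge0 andbT.
  have inv0 : (phi k).+1%:R^-1 @[k --> \oo] --> (0 : R).
    exact: (cvg_comp phi (@harmonic R) (cvg_subseq_infty phi_ge) cvg_harmonic).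
  have rhs : (phi k).+1%:R^-1 * (2 * (peval g x - peval g (z (phi k))))
      @[k --> \oo] --> (0 : R).
    rewrite -[X in _ --> X](mul0r (2 * (peval g x - peval g x'))).
    exact: (cvgM inv0 (cvgM (cvg_cst (2 : R)) (cvgB (cvg_cst (peval g x)) gz))).
  apply: (ler_cvg_to penz rhs); apply: nearW => k.
  rewrite mulrC ler_pdivlMr//; have := bound (phi k).
  have := dotv_ge0 (z (phi k) - x); lra.
have fx' : feasible x'.
  move=> j; apply/eqP; rewrite -sqrf_eq0 eq_le sqr_ge0 andbT -pen_x' /pen.
  by rewrite (bigD1 j)//= lerDl; apply: sumr_ge0 => i _; exact: sqr_ge0.
(* Minimality of [x] then leaves no room for the proximal term. *)
have xx' : x' = x.
  apply/eqP; rewrite -subr_eq0; apply/eqP/dotv_eq0/eqP.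
  rewrite eq_le dotv_ge0 andbT.
  have : peval g x' + 2^-1 * dotv (x' - x) (x' - x) <= peval g x.
    have lhs : peval g (z (phi k)) + 2^-1 * dotv (z (phi k) - x) (z (phi k) - x)
        @[k --> \oo] --> peval g x' + 2^-1 * dotv (x' - x) (x' - x).
      exact: (cvgD gz (cvgM (cvg_cst (2^-1 : R)) ddz)).
    apply: (ler_cvg_to lhs (cvg_cst (peval g x))); apply: nearW => k /=.
    have := bound (phi k); have := pen_ge0 (z (phi k)).
    have : 0 <= (phi k).+1%:R / 2 :> R by [].
    move=> p0 p1; have := mulr_ge0 p0 p1; lra.
  have := rmin x' Cx'.1 Cx'.2 fx'; lra.
move: zx' dz {gz penz ddz pen_x' fx' Cx'}; rewrite {}xx' subrr => zx dz.
pose l k : R := (mass k.+1%:R (z k))^-1.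
have lE k : l k = 1 - \sum_(j : J) `|B k 0 (enum_rank j)|.
  apply/eqP; rewrite eq_sym subr_eq eq_sym -(multiplier_mass k.+1%:R (z k)).
  apply/eqP; congr (_ + _); apply: eq_bigr => j _.
  by rewrite mxE enum_rankK.
pose b' j : R := b 0 (enum_rank j); pose l' := 1 - \sum_(j : J) `|b' j|.
have Bj j : B (phi k) 0 (enum_rank j) @[k --> \oo] --> b' j by exact: cvg_coord.
have lim_l : l (phi k) @[k --> \oo] --> l'.
  under eq_cvg do rewrite lE.
  apply: cvgB; first exact: cvg_cst.
  apply: (@cvg_sum_fin R _ _ (nbhs \oo) _ _ _
    (fun j k => `|B (phi k) 0 (enum_rank j)|)) => j _.
  by apply: cvg_norm; exact: Bj.
exists l', b', (- (l' *: grad g x + \sum_(j : J) b' j *: grad (u j) x)); split.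
- apply: (ler_cvg_to (cvg_cst (0 : R)) lim_l); apply: nearW => k.
  by rewrite invr_ge0 (le_trans ler01 (mass_ge1 _ _)).
- move=> j ej; apply: (ler_cvg_to (cvg_cst (0 : R)) (Bj j)); apply: nearW => k.
  rewrite mxE enum_rankK /multiplier.
  rewrite mulr_ge0 ?invr_ge0 ?(le_trans ler01 (mass_ge1 _ _))//.
  by rewrite mulr_ge0// (negbTE ej) excess_ge0.
- by rewrite /l' subrK.
- pose v k := - (l k *: grad g (z k)
      + \sum_(j : J) B k 0 (enum_rank j) *: grad (u j) (z k) + l k *: (z k - x)).
  apply: (@normal_cone_lim _ _ _ _ _ (z \o phi) (v \o phi)) => //.
    have near_x : \forall k \near \oo, `|x - z (phi k)| < r.
      by move/cvgrPdist_lt: zx; exact.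
    apply: filterS near_x => k xz; split; first by have [] := Cz (phi k).
    have -> : (v \o phi) k = l (phi k) *: - (grad g (z (phi k))
        + \sum_(j : J) ((phi k).+1%:R * excess (e j) (peval (u j) (z (phi k))))
            *: grad (u j) (z (phi k)) + (z (phi k) - x)).
      rewrite /v /= scalerN !scalerDr scaler_sumr; congr (- (_ + _ + _)).
      by apply: eq_bigr => j _; rewrite mxE enum_rankK scalerA.
    apply: regular_normalZ.
      by rewrite invr_gt0 (lt_le_trans ltr01 (mass_ge1 _ _)).
    apply: penalized_regular_normal => //.
    apply/nbhs_ballP; exists (r - `|x - z (phi k)|); first by rewrite /= subr_gt0.
    move=> y; rewrite -ball_normE /ball_ /= => zy Ky; apply: zmin; split=> //=.
    rewrite -(subrK (z (phi k)) x) -addrA (le_trans (ler_normD _ _))//; lra.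
  have -> : l' *: grad g x + \sum_(j : J) b' j *: grad (u j) x
      = l' *: grad g x + \sum_(j : J) b' j *: grad (u j) x + l' *: (0 : 'rV_n).
    by rewrite scaler0 addr0.
  apply: cvgN; apply: cvgD; first apply: cvgD.
  + by apply: cvgZ => //; exact: cvg_grad.
  + apply: (@cvg_sum_fin _ _ _ (nbhs \oo) _ _ _
      (fun j k => B (phi k) 0 (enum_rank j) *: grad (u j) (z (phi k)))) => j _.
    by apply: cvgZ; [exact: Bj|exact: cvg_grad].
  + exact: cvgZ.
- by rewrite subrr.
Qed.

End FritzJohn.

(** * Asymptotic cones and asymptotic polynomials *)

Section BoundedSets.
Context {R : realType} {n : nat}.
Implicit Types (S : set 'rV[R]_n) (v x : 'rV[R]_n) (c : R).

Lemma bounded_setP S : bounded_set S <-> exists M : R, forall x, S x -> `|x| <= M.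
Proof.
split=> [[M [_ SM]]|[M SM]]; first by exists (M + 1); apply: SM; rewrite ltrDl.
by exists M; split=> [|c /ltW Mc x Sx]; [exact: num_real|exact: le_trans (SM x Sx) Mc].
Qed.

Lemma unbounded_enorm S c : ~ bounded_set S -> exists2 x, S x & c <= enorm x.
Proof.
move=> Sunb; apply: contra_notP Sunb => Sc; apply/bounded_setP; exists c => x Sx.
apply: le_trans (norm_le_enorm x) _; rewrite leNgt; apply/negP => cx.
by apply: Sc; exists x => //; exact: ltW.
Qed.

Lemma bounded_no_escape S (x : nat -> 'rV[R]_n) :
  bounded_set S -> (forall k, S (x k)) -> ~ (enorm (x k) @[k --> \oo] --> +oo).
Proof.
move=> /bounded_setP[M SM] Sx /cvgryPgt/(_ (n%:R * M))[N _ /(_ N (leqnn N)) /=].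
apply/negP; rewrite -leNgt (le_trans (enorm_le_norm _))//.
by rewrite ler_wpM2l// SM.
Qed.

Lemma cvg_inv_infty (T : Type) (F : set_system T) {FF : Filter F} (t : T -> R) :
  t k @[k --> F] --> +oo -> (t k)^-1 @[k --> F] --> (0 : R).
Proof.
move=> too; apply/(gtr0_cvgV0 _) => //.
by move/cvgryPgt: too; exact.
Qed.

Lemma asym_coneZ S v c : 0 < c -> asym_cone S v -> asym_cone S (c *: v).
Proof.
move=> c0 [t [x [too Sx xv]]]; exists (fun k => c^-1 * t k), x; split=> //.
- apply/cvgryPge => A; move/cvgryPge: too => /(_ (c * A)).
  by apply: filterS => k; rewrite [c^-1 * _]mulrC ler_pdivlMr// mulrC.
- under eq_cvg do rewrite invfM invrK -scalerA.
  by apply: cvgZl_tmp.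
Qed.

(** Directions of points going to infinity accumulate on the unit sphere. *)
Lemma asym_cone_ray S : ~ bounded_set S -> exists2 v, v != 0 & asym_cone S v.
Proof.
move=> Sunb.
have ex (k : nat) : exists x, S x /\ k.+1%:R <= `|x|.
  apply: contra_notP Sunb => Sk; apply/bounded_setP; exists k.+1%:R => x Sx.
  by rewrite leNgt; apply/negP => kx; apply: Sk; exists x; split=> //; exact: ltW.
have [x xP] := choice ex.
have x0 k : 0 < `|x k| by apply: lt_le_trans (xP k).2.
pose y k := `|x k|^-1 *: x k.
have y1 k : `|y k| = 1 by rewrite normrZ normfV normr_id mulVf// gt_eqF.
have ballc := @compact_closed_ball R n setT 0 1 closedT.
have yball k : ([set: 'rV[R]_n] `&` [set y | `|0 - y| <= 1]) (y k).
  by split=> //=; rewrite sub0r normrN y1.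
have [phi [v [_ phi_ge yv]]] := compact_subseq ballc yball.
exists v.
  have v1 : `|v| = 1.
    have : `|y (phi k)| @[k --> \oo] --> `|v| by exact: cvg_norm.
    under eq_cvg do rewrite y1.
    by move/(cvg_lim (@norm_hausdorff _ _)) <-; rewrite lim_cst.
  by rewrite -normr_gt0 v1.
exists (fun k => `|x (phi k)|), (x \o phi); split=> //.
- apply/cvgryPge => A.
  have : \forall k \near \oo, A <= k%:R by exact: nbhs_infty_ger.
  apply: filterS => k Ak; apply: le_trans Ak _; apply: le_trans (xP (phi k)).2.
  by rewrite ler_nat (leq_trans (phi_ge k)).
- by move=> k; have [] := xP (phi k).
Qed.

(** A bounded set has no asymptotic direction but 0, an unbounded one has a ray. *)
Lemma bounded_asym_cone S : bounded_set (asym_cone S) <-> bounded_set S.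
Proof.
split=> [/bounded_setP[M coneM]|/bounded_setP[M SM]].
  apply: contrapT => /asym_cone_ray[v v0 vS].
  have nv : 0 < `|v| by rewrite normr_gt0.
  have c0 : 0 < (`|M| + 1) / `|v| by rewrite divr_gt0// ltr_wpDl.
  have := coneM _ (asym_coneZ c0 vS).
  rewrite normrZ gtr0_norm// divfK ?gt_eqF//.
  by apply/negP; rewrite -ltNge (le_lt_trans (ler_norm _))// ltrDl.
apply/bounded_setP; exists 0 => v [t [x [too Sx xv]]].
have M0 : 0 <= M := le_trans (normr_ge0 _) (SM _ (Sx 0%N)).
have lim0 : `|(t k)^-1| * M @[k --> \oo] --> (0 : R).
  rewrite -[X in _ --> X](mul0r M) -(@normr0 _ R).
  exact: (cvgM (cvg_norm (cvg_inv_infty too)) (cvg_cst M)).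
apply: (ler_cvg_to (cvg_norm xv) lim0); apply: nearW => k.
by rewrite normrZ ler_wpM2l// SM.
Qed.

End BoundedSets.

Section AsymptoticPolynomial.
Context {R : realType} {n : nat}.
Implicit Types (S : set 'rV[R]_n) (p : mpoly.mpoly n R) (x y v : 'rV[R]_n) (s t : R).

(** Joint continuity of the homogenisation in [(s, y)] lets the limits along a ray
    and along an arbitrary sequence with the same asymptotic direction be compared:
    both equal its value at [s = 0], the leading form of [p]. *)
Definition homogenize p s y : R :=
  \sum_(m <- mpoly.msupp p)
    mpoly.mcoeff m p * (s ^+ (pdeg p - mpoly.mdeg m) * \prod_(i < n) y 0 i ^+ m i).

Lemma homogenizeE p t x : t != 0 ->
  peval p x / t ^+ pdeg p = homogenize p t^-1 (t^-1 *: x).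
Proof.
move=> t0; rewrite /peval mpoly.mevalE mulr_suml; apply: eq_big_seq => m mp.
have md : (mpoly.mdeg m <= pdeg p)%N.
  by rewrite -ltnS (leq_trans (mpoly.msize_mdeg_lt mp))// leqSpred.
rewrite -mulrA; congr (_ * _).
under [X in _ = _ * X]eq_bigr do rewrite mxE exprMn.
rewrite big_split /= prodrXr -mpoly.mdegE mulrA -exprD subnK//.
by rewrite mulrC exprVn.
Qed.

Lemma cvg_homogenize (T : Type) (F : set_system T) {FF : Filter F}
    p (s : T -> R) (y : T -> 'rV[R]_n) s0 y0 :
  s k @[k --> F] --> s0 -> y k @[k --> F] --> y0 ->
  homogenize p (s k) (y k) @[k --> F] --> homogenize p s0 y0.
Proof.
move=> ss yy; apply: (@cvg_sum_fin R _ _ F _ _ _ (fun m k =>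
  mpoly.mcoeff m p
  * (s k ^+ (pdeg p - mpoly.mdeg m) * \prod_(i < n) y k 0 i ^+ m i))).
move=> m _; apply: cvgM; first exact: cvg_cst.
apply: cvgM; first exact: cvg_exprn.
apply: (@cvg_prod_fin R _ _ F _ _ _ (fun i k => y k 0 i ^+ m i)) => i _.
by apply: cvg_exprn; exact: cvg_coord.
Qed.

Lemma asym_polyE p v : asym_poly p v = homogenize p 0 v.
Proof.
apply: cvg_lim => //.
have tinv : t^-1 @[t --> +oo] --> (0 : R) by apply: cvg_inv_infty; exact: cvg_id.
have : homogenize p t^-1 v @[t --> +oo] --> homogenize p 0 v.
  by apply: cvg_homogenize => //; exact: cvg_cst.
apply: cvg_trans.
apply: near_eq_cvg; near=> t.
have t0 : t != 0 by rewrite gt_eqF//; near: t; exact: nbhs_pinfty_gt.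
by rewrite homogenizeE// scalerA mulVf// scale1r.
Unshelve. all: by end_near. Qed.

(** Along a sequence of [S] with asymptotic direction [v], the quotient of [p] by
    [t ^+ pdeg p] tends to the leading form at [v], and also to 0 since [p] is bounded.
    In degree 0 the polynomial is constant. *)
Lemma asym_poly_bounded S p v :
  (exists M : R, forall x, S x -> `|peval p x| <= M) -> asym_cone S v ->
  asym_poly p v = if (0 < pdeg p)%N then 0 else peval p 0.
Proof.
move=> [M SM] [t [x [too Sx xv]]].
have tinv : (t k)^-1 @[k --> \oo] --> (0 : R) by exact: cvg_inv_infty.
case: ifPn => [d0|]; last first.
  rewrite -eqn0Ngt => /eqP d0; apply: cvg_lim => //; rewrite d0.
  have pC := mpoly.msize1_polyC (_ : (mpoly.msize p <= 1)%N).
  rewrite pC; last first.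
    by move: d0; rewrite /pdeg; case: (mpoly.mmeasure _ p) => [|[]].
  under eq_cvg do rewrite pevalC expr0 divr1.
  by rewrite pevalC; exact: cvg_cst.
have lim0 : (t k)^-1 ^+ pdeg p @[k --> \oo] --> (0 : R).
  rewrite -[X in _ --> X](_ : 0 ^+ pdeg p = 0); first exact: cvg_exprn.
  by rewrite expr0n gtn_eqF.
have limp : peval p (x k) / t k ^+ pdeg p @[k --> \oo] --> asym_poly p v.
  rewrite asym_polyE; have : homogenize p (t k)^-1 ((t k)^-1 *: x k) @[k --> \oo] -->
      homogenize p 0 v by exact: cvg_homogenize.
  apply: cvg_trans.
  apply: near_eq_cvg; move/cvgryPgt: too => /(_ 0).
  by apply: filterS => k tk; rewrite homogenizeE// gt_eqF.
have lim0' : M * `|(t k)^-1 ^+ pdeg p| @[k --> \oo] --> (0 : R).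
  rewrite -[X in _ --> X](mulr0 M) -(@normr0 _ R).
  exact: (cvgM (cvg_cst M) (cvg_norm lim0)).
apply/eqP; rewrite -normr_le0.
apply: (ler_cvg_to (cvg_norm limp) lim0'); apply: nearW => k /=.
by rewrite normrM -exprVn ler_wpM2r// SM.
Qed.

End AsymptoticPolynomial.

(** * Sections of a vector polynomial *)

(** [inf A] is the lower limit of [h] at infinity in [S]. Beyond some radius [h]
    exceeds [inf A - eps / 2], while points with value below [inf A + eps / 2] occur
    arbitrarily far out. *)
Lemma almost_minimal_at_infinity (R : realType) (n : nat) (S : set 'rV[R]_n)
    (h : 'rV[R]_n -> R) (m M eps c : R) :
  ~ bounded_set S -> (forall x, S x -> m <= h x <= M) -> 0 < eps ->
  exists z, [/\ S z, c <= enorm z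
    & forall x, S x -> enorm z / 2 <= enorm x -> h z - eps <= h x].
Proof.
move=> Sunb hb eps0.
pose A := [set a | forall rho : R, exists2 x, S x & rho <= enorm x /\ h x <= a].
have A0 : A !=set0.
  exists M => rho; have [x Sx rx] := unbounded_enorm rho Sunb.
  by exists x => //; split=> //; have /andP[] := hb x Sx.
have Alb : has_lbound A.
  by exists m => a /(_ 0)[x Sx [_]]; apply: le_trans; have /andP[] := hb x Sx.
have e2 : 0 < eps / 2 by rewrite divr_gt0.
have [rho rhoP] : exists rho : R, forall x, S x -> rho <= enorm x ->
    inf A - eps / 2 < h x.
  have : ~ A (inf A - eps / 2) by move=> /(ge_inf Alb); lra.
  move/existsNP => [rho rhoP]; exists rho => x Sx rx; rewrite ltNge; apply/negP => hx.
  by apply: rhoP; exists x.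
have [a Aa aA] := inf_adherent e2 (conj A0 Alb).
have [z Sz [rz hz]] := Aa (Num.max c (2 * rho)).
move: rz; rewrite ge_max => /andP[cz rz].
exists z; split=> // x Sx zx; have rx : rho <= enorm x by lra.
by have := rhoP x Sx rx; lra.
Qed.

Section ParetoSections.
Context {R : realType} {n q : nat}.
Variables (K : set 'rV[R]_n) (f : 'I_q -> mpoly.mpoly n R) (xbar : 'rV[R]_n).
Implicit Types (x z w : 'rV[R]_n) (eps c : R) (i : 'I_q).

Let Kx := section f K xbar.
Let u i : mpoly.mpoly n R := f i - mpoly.mpolyC n (peval (f i) xbar).

Lemma sectionP x : Kx x <-> K x /\ forall i, peval (f i) x <= peval (f i) xbar.
Proof.
by split=> -[Kx' fx]; split=> // i; move: (fx i); rewrite !mxE subr_ge0.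
Qed.

Lemma section_closed : closed K -> closed Kx.
Proof.
move=> Kc.
rewrite (_ : Kx = K `&`
  \bigcap_i (peval (f i) @^-1` [set y | y <= peval (f i) xbar])).
  apply: closedI => //; apply: closed_bigI => i _.
  apply: closed_comp; last exact: closed_le.
  by move=> x _; exact: peval_continuous.
apply/seteqP; split=> x /=; rewrite sectionP => -[Kx' fx]; split=> // i.
  by move=> _; exact: fx.
exact: fx.
Qed.

Lemma vle_ext_section x :
  K x -> vle_ext (vval f x) (ext_level (vval f xbar)) -> Kx x.
Proof.
move=> Kx' fx; apply/sectionP; split=> // i.
by have := fx i; rewrite /ext_level !mxE lee_fin.
Qed.

Lemma section_vle_ext x : Kx x -> vle_ext (vval f x) (ext_level (vval f xbar)).
Proof. by move=> /sectionP[_ fx] i; rewrite /ext_level !mxE lee_fin. Qed.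

Lemma compact_section : closed K -> bounded_set Kx -> compact Kx.
Proof.
by move=> /section_closed Kxc Kxb; exact: bounded_closed_compact.
Qed.

(** A minimiser of the sum of all objectives over the compact section is efficient:
    a dominating point lies in the section and has a smaller sum. *)
Lemma pareto_of_bounded : closed K -> K xbar -> bounded_set Kx ->
  SOLs K (vval f) !=set0.
Proof.
move=> Kc Kxbar Kb.
pose h : mpoly.mpoly n R := \sum_(i < q) f i.
have Kx0 : Kx !=set0 by exists xbar; apply/sectionP.
have [s [Kxs smin]] :=
  compact_argmin Kx0 (compact_section Kc Kb) (@peval_continuous _ _ h).
have [Ks fs] := (sectionP s).1 Kxs.
exists s; split=> // x Kx' [c [c0 cn0] cE].
have fx i : peval (f i) x = peval (f i) s - c 0 i.
  by have /rowP/(_ i) := cE; rewrite !mxE => ->; ring.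
have := smin x; rewrite !peval_sum; apply/not_implyP; split.
  by apply/sectionP; split=> // i; rewrite fx; have := fs i; have := c0 i; lra.
apply/negP; rewrite -ltNge; under eq_bigr do rewrite fx.
rewrite sumrB ltrBlDr ltrDl lt_neqAle sumr_ge0 ?andbT; last by move=> i _; exact: c0.
apply: contra_notN cn0 => /eqP c00; apply/rowP => i; rewrite mxE.
by apply: (psumr_eq0P (P := xpredT) (F := fun i => c 0 i)) => // j _; exact: c0.
Qed.

Lemma rabier_ge0 x : 0 <= rabier f K x.
Proof.
rewrite /rabier; set A := [set r | _].
have [->|/set0P A0] := eqVneq A set0; first by rewrite inf0.
by apply: lb_le_inf => // r [a [w [_ _ _ ->]]]; exact: enorm_ge0.
Qed.

Lemma rabier_le x (a : 'I_q -> R) w :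
  (forall i, 0 <= a i) -> \sum_(i < q) a i = 1 -> normal_cone K x w ->
  rabier f K x <= enorm (\sum_(i < q) a i *: grad (f i) x + w).
Proof.
move=> a0 a1 wN; apply: ge_inf.
  by exists 0 => r [? [? [_ _ _ ->]]]; exact: enorm_ge0.
exists (\row_i a i), w; split=> //.
- by move=> i; rewrite mxE.
- by under eq_bigr do rewrite mxE.
- by congr (enorm (_ + _)); apply: eq_bigr => i _; rewrite mxE.
Qed.

Lemma grad_shift i x : grad (u i) x = grad (f i) x.
Proof. by rewrite gradB gradC subr0. Qed.

Lemma excess_shift i x : (excess false (peval (u i) x) = 0) <->
  peval (f i) x <= peval (f i) xbar.
Proof.
rewrite /excess pevalB pevalC; split=> [|fx]; last by apply: max_l; lra.
by move=> /eqP; rewrite eq_le ge_max lexx /= => /andP[]; lra.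
Qed.

Section Multipliers.
Variable i0 : 'I_q.

(** The multiplier of the objective [f i0] is merged into that of the constraint
    of the same index. *)
Lemma merge_multiplier (l : R) (b : 'I_q -> R) x :
  let a i := b i + l * (i == i0)%:R in
  \sum_(i < q) a i = \sum_(i < q) b i + l /\
  \sum_(i < q) a i *: grad (f i) x
    = l *: grad (f i0) x + \sum_(i < q) b i *: grad (f i) x.
Proof.
move=> a; split.
  rewrite big_split /= -mulr_sumr; congr (_ + _).
  by rewrite (bigD1 i0)//= eqxx big1 ?addr0 ?mulr1// => i /negbTE ->.
under eq_bigr do rewrite scalerDl; rewrite big_split /= addrC; congr (_ + _).
rewrite (bigD1 i0)//= eqxx mulr1 big1 ?addr0// => i /negbTE ->.
by rewrite mulr0 scale0r.
Qed.

(** A smooth substitute for Ekeland's principle. Perturb [f i0] by a multiple of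
    [|x - z|^2], where [z] is almost minimal at infinity. A minimiser over the part of
    the section in a ball of radius [r = |z| / 2] around [z] then lies inside the
    ball, so only the section constraints are active there, and the multiplier rule
    bounds the Rabier function by the gradient of the perturbation, of order
    [eps / r]. The section constraints contribute gradients of the [f i], which the
    convex combination in the Rabier function absorbs: this is why normals to [K],
    rather than to the section, suffice. *)
Lemma small_rabier_at_infinity (m M eps c : R) :
  closed K -> ~ bounded_set Kx ->
  (forall x, Kx x -> m <= peval (f i0) x <= M) -> 0 < eps ->
  exists x, [/\ Kx x, c <= enorm x & enorm x * rabier f K x <= eps].
Proof.
move=> Kc Kunb fb eps0.
(* Below, [|x| <= 4 r] and the Rabier function is at most [4 eps1 / r]. *)
pose eps1 := eps / 16; have eps10 : 0 < eps1 by rewrite divr_gt0.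
have [z [Kxz cz zmin]] :=
  almost_minimal_at_infinity (Num.max 1 (2 * c)) Kunb fb eps10.
move: cz; rewrite ge_max => /andP[z1 cz].
pose r := enorm z / 2; have r0 : 0 < r by rewrite divr_gt0// (lt_le_trans ltr01 z1).
have zz : dotv z z = 4 * r ^+ 2 by rewrite -enorm_sqr /r; field.
pose C := Kx `&` [set x | dotv (x - z) (x - z) <= r ^+ 2].
have dcont : continuous (fun x => dotv (x - z) (x - z)).
  move=> x; have xz : y - z @[y --> x] --> x - z.
    exact: (cvgB (@cvg_id _ (nbhs x)) (cvg_cst z)).
  exact: (cvg_dotv xz xz).
have Cc : compact C.
  apply: bounded_closed_compact; last first.
    apply: closedI; first exact: section_closed.
    by apply: (@closed_comp _ _ (fun x => dotv (x - z) (x - z)) [set y | y <= r ^+ 2]);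
       [move=> x _; exact: dcont|exact: closed_le].
  apply/bounded_setP; exists (`|z| + r) => x [_ /= xz].
  rewrite -(subrK z x) addrC (le_trans (ler_normD _ _))// lerD2l.
  apply: (le_trans (norm_le_enorm _)).
  by rewrite -(@ler_pXn2r _ 2) ?nnegrE ?enorm_ge0 ?(ltW r0)// enorm_sqr.
have Cz : C z by split=> //=; rewrite subrr dot0v sqr_ge0.
(* At distance [r] the perturbation is [2 eps1], more than the possible gain
   [eps1] in [f i0]. *)
pose theta := 4 * eps1 / r ^+ 2.
have theta0 : 0 < theta by rewrite divr_gt0 ?exprn_gt0// mulr_gt0.
pose g : mpoly.mpoly n R := f i0 + theta *: half_sqdist z.
have gE x : peval g x = peval (f i0) x + theta * (2^-1 * dotv (x - z) (x - z)).
  by rewrite pevalD pevalZ peval_half_sqdist.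
have [x [[Kxx xz] xmin]] :=
  compact_argmin (ex_intro _ z Cz) Cc (@peval_continuous _ _ g).
have [Kx' fx] := (sectionP x).1 Kxx.
have rx : r <= enorm x.
  rewrite -(@ler_pXn2r _ 2) ?nnegrE ?enorm_ge0 ?(ltW r0)// enorm_sqr.
  have := dotv_sub_le z x; rewrite -opprB dotvNl dotvNr opprK zz.
  move: xz => /=; lra.
have xz2 : dotv (x - z) (x - z) <= r ^+ 2 / 2.
  have := xmin z Cz; rewrite !gE subrr dot0v !mulr0 addr0.
  have := zmin x Kxx rx => h1 h2.
  have : theta * (2^-1 * dotv (x - z) (x - z)) <= eps1 by lra.
  rewrite -ler_pdivlMl//.
  have -> : theta^-1 * eps1 = r ^+ 2 / 4 by rewrite /theta; field; rewrite !gt_eqF.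
  lra.
have [||l [b [w [l0 b0 lb wN grad0]]]] :=
  @fritz_john R n 'I_q K g pred0 u x Kc Kx'.
- by move=> i; apply/excess_shift.
- have : \forall y \near x, dotv (y - z) (y - z) < r ^+ 2.
    apply: (@cvgr_lt _ _ (nbhs x) _ (fun y => dotv (y - z) (y - z)) _ (dcont x)).
    by apply: le_lt_trans xz2 _; have := exprn_gt0 2 r0; lra.
  apply: filterS => y yz Ky fy; apply: xmin; split; last exact: ltW.
  by apply/sectionP; split=> // i; apply/excess_shift; exact: fy.
have bE : \sum_(i < q) b i = 1 - l.
  rewrite -lb addrAC subrr add0r; apply: eq_bigr => i _.
  by rewrite ger0_norm// b0.
have [aE agrad] := merge_multiplier l b x.
exists x; split=> //; first by apply: le_trans rx; rewrite /r; lra.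
have l1 : l <= 1.
  by rewrite -lb lerDl sumr_ge0.
have -> : eps = enorm z * 2 * (theta * r).
  rewrite /theta /eps1 /r; field.
  by rewrite gt_eqF// (lt_le_trans ltr01 z1).
apply: ler_pM; rewrite ?enorm_ge0 ?rabier_ge0//.
  rewrite -(@ler_pXn2r _ 2) ?nnegrE ?enorm_ge0 ?mulr_ge0 ?enorm_ge0// enorm_sqr.
  rewrite exprMn enorm_sqr zz; have := dotv_sub_le x z; rewrite zz.
  have := sqr_ge0 r; move: xz => /=; lra.
have a0 i : 0 <= b i + l * (i == i0)%:R by rewrite addr_ge0 ?b0// mulr_ge0.
have a1 : \sum_(i < q) (b i + l * (i == i0)%:R) = 1 by rewrite aE bE subrK.
apply: (le_trans (rabier_le a0 a1 wN)); rewrite agrad.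
have -> : l *: grad (f i0) x + \sum_(i < q) b i *: grad (f i) x + w
    = - ((l * theta) *: (x - z)).
  apply/eqP; rewrite -addr_eq0 [X in _ == X]grad0; apply/eqP.
  rewrite /g gradD gradZ grad_half_sqdist -scalerA [l *: (_ + theta *: _)]scalerDr.
  under [in RHS]eq_bigr do rewrite grad_shift.
  by rewrite addrAC; congr (_ + _); rewrite addrAC.
rewrite enormN enormZ ger0_norm; last by rewrite mulr_ge0// ltW.
have xr : enorm (x - z) <= r.
  by rewrite -(@ler_pXn2r _ 2) ?nnegrE ?enorm_ge0 ?(ltW r0)// enorm_sqr.
have lt : l * theta <= theta by rewrite ler_piMl// ltW.
apply: (le_trans (ler_wpM2r (enorm_ge0 _) lt)).
by rewrite ler_wpM2l// ltW.
Qed.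

(** Minimise [f i0] over the points of the section on the sphere through a far
    point [z]. The sphere, being an equality constraint, contributes [mu *: x] with
    [mu] of either sign, and the normalisation of the multipliers is the one in the
    definition of the tangency variety. *)
Lemma tangency_at_infinity (c : R) : closed K -> ~ bounded_set Kx ->
  exists x, [/\ Kx x, c <= enorm x & tangency_variety f K x].
Proof.
move=> Kc Kunb; have [z Kxz cz] := unbounded_enorm c Kunb.
pose C := Kx `&` [set x | dotv x x = dotv z z].
have dcont : continuous (fun x : 'rV[R]_n => dotv x x).
  by move=> x; exact: (cvg_dotv (@cvg_id _ (nbhs x)) (@cvg_id _ (nbhs x))).
have Cc : compact C.
  apply: bounded_closed_compact; last first.
    apply: closedI; first exact: section_closed.
    by apply: (@closed_comp _ _ (fun x => dotv x x) [set y | y = dotv z z]);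
       [move=> x _; exact: dcont|exact: closed_eq].
  apply/bounded_setP; exists (enorm z) => x [_ /= xz].
  by apply: (le_trans (norm_le_enorm _)); rewrite /enorm xz.
have Cz : C z by [].
have [x [[Kxx xz] xmin]] :=
  compact_argmin (ex_intro _ z Cz) Cc (@peval_continuous _ _ (f i0)).
have [Kx' fx] := (sectionP x).1 Kxx.
pose e (j : unit + 'I_q) := if j is inl _ then true else false.
pose v (j : unit + 'I_q) : mpoly.mpoly n R :=
  if j is inr i then u i else half_sqdist 0 - mpoly.mpolyC n (2^-1 * dotv z z).
have vE y : peval (v (inl tt)) y = 2^-1 * dotv y y - 2^-1 * dotv z z.
  by rewrite pevalB pevalC peval_half_sqdist subr0.
have [||l [b [w [l0 b0 lb wN grad0]]]] :=
  @fritz_john R n _ K (f i0) e v x Kc Kx'.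
- case=> [[]|i]; last exact/excess_shift.
  by rewrite /excess /= vE xz subrr.
- apply: (@nearW _ (nbhs x)) => y Ky fy; apply: xmin; split.
    by apply/sectionP; split=> // i; apply/excess_shift; exact: (fy (inr i)).
  by have := fy (inl tt); rewrite /excess /= vE; lra.
exists x; split=> //; first by rewrite /enorm xz.
split=> //.
have [aE agrad] := merge_multiplier l (fun i => b (inr i)) x.
have b0' i : 0 <= b (inr i) by apply: b0.
exists (\row_i (b (inr i) + l * (i == i0)%:R)), (b (inl tt)); split.
- by move=> i; rewrite mxE addr_ge0// mulr_ge0.
- under eq_bigr do rewrite mxE.
  rewrite aE -lb big_sumType /= (big_pred1 tt); last by case.
  under [X in _ = _ + (_ + X)]eq_bigr do rewrite ger0_norm//.
  by ring.
- exists w => //; rewrite [LHS]grad0 big_sumType /= (big_pred1 tt); last by case.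
  under eq_bigr do rewrite grad_shift.
  under [in RHS]eq_bigr do rewrite mxE.
  rewrite agrad gradB gradC grad_half_sqdist !subr0.
  by congr (_ + w); rewrite -addrA; congr (_ + _); exact: addrC.
Qed.

End Multipliers.
End ParetoSections.

(** * Boundedness of the section and the six conditions *)

Lemma interior_orthant_gt0 (R : realType) (q : nat) (c : 'rV[R]_q) (i : 'I_q) :
  interior orthant c -> 0 < c 0 i.
Proof.
move=> /nbhs_ballP[d /= d0 dP].
have : orthant (c - (d / 2) *: delta_mx 0 i).
  apply: dP; rewrite -ball_normE /ball_ /= opprB addrC subrK normrZ.
  rewrite gtr0_norm ?divr_gt0//.
  have n1 : `|delta_mx 0 i : 'rV[R]_q| <= 1.
    apply: norm_le_coords => // j; rewrite mxE eqxx /=.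
    by case: (j == i); rewrite ?normr1 ?normr0.
  have := ler_wpM2l (ltW (divr_gt0 d0 (ltr0n R 2))) n1; lra.
by move=> /(_ i); rewrite !mxE !eqxx /= mulr1; lra.
Qed.

Section Equivalences.
Context {R : realType} {n q : nat}.
Variables (K : set 'rV[R]_n) (f : 'I_q -> mpoly.mpoly n R) (xbar : 'rV[R]_n).
Variable I : {set 'I_q}.
Hypotheses (Kclosed : closed K) (Kxbar : K xbar).
Hypothesis fdeg : forall i, (1 <= pdeg (f i))%N.
Hypothesis I0 : I != finset.set0.
Hypothesis fbound : section_bounded_below f K I xbar.

Let Kx := section f K xbar.
Let y0 := ext_level (vval f xbar).

Lemma section_value_bounds i : i \in I ->
  exists m, forall x, Kx x -> m <= peval (f i) x <= peval (f i) xbar.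
Proof.
move=> /fbound[m mP]; exists m => x Kx'; have [_ ->] := (sectionP _ _ _ _).1 Kx'.
by rewrite andbT; apply: mP; exists x.
Qed.

Lemma section_values_bounded i : i \in I ->
  exists M : R, forall x, Kx x -> `|peval (f i) x| <= M.
Proof.
move=> /section_value_bounds[m mP]; exists (`|m| + `|peval (f i) xbar|) => x /mP.
have := ler_norm (peval (f i) xbar); have := lerNnormlW (lexx `|m|).
have := normr_ge0 m; have := normr_ge0 (peval (f i) xbar).
by rewrite ler_norml => ? ? ? ? /andP[? ?]; apply/andP; split; lra.
Qed.

Lemma combination_bounded (lam : 'rV[R]_q) : [set i | lam 0 i != 0]%SET = I ->
  exists M : R, forall x, Kx x -> `|peval (\sum_(i < q) lam 0 i *: f i) x| <= M.
Proof.
move=> lamI.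
have ex i : exists M : R, forall x, Kx x -> `|lam 0 i * peval (f i) x| <= M.
  have [->|li] := eqVneq (lam 0 i) 0.
    by exists 0 => x _; rewrite mul0r normr0.
  have [|M fM] := @section_values_bounded i; first by rewrite -lamI finset.inE.
  by exists (`|lam 0 i| * M) => x Kx'; rewrite normrM ler_wpM2l// fM.
have [M MP] := choice ex; exists (\sum_i M i) => x Kx'.
rewrite peval_sum; under eq_bigr do rewrite pevalZ.
by apply: (le_trans (ler_norm_sum _ _ _)); apply: ler_sum => i _; exact: MP.
Qed.

Lemma asym_vec0 i v : i \in I -> asym_cone Kx v -> asym_vec f v 0 i = 0.
Proof.
move=> /section_values_bounded iI vcone; rewrite mxE (asym_poly_bounded iI vcone).
by rewrite (fdeg i).
Qed.

Lemma section_admissible : admissible f K Kx.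
Proof.
split; first by exists xbar; apply/sectionP.
  exact: section_closed.
exists xbar => //; split=> // v [t [x [too Kx' xv]]].
by exists t, x; split=> // k; have [] := Kx' k.
Qed.

Lemma bounded_subset_cone (S : set 'rV[R]_n) :
  bounded_set Kx -> S `<=` asym_cone Kx -> bounded_set S.
Proof.
move=> /bounded_asym_cone/bounded_setP[M MP] Scone.
by apply/bounded_setP; exists M => x /Scone; exact: MP.
Qed.

Lemma bounded_of_cone_subset (S : set 'rV[R]_n) :
  bounded_set S -> asym_cone Kx `<=` S -> bounded_set Kx.
Proof.
move=> /bounded_setP[M MP] Scone; apply/bounded_asym_cone.
by apply/bounded_setP; exists M => x /Scone; exact: MP.
Qed.

(** A polynomial bounded on the section has constant asymptotic polynomial on the
    asymptotic cone, so every point of the cone is a minimiser. Hence boundedness of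
    the solution set is boundedness of the cone, and so of the section. *)
Lemma zero_regular_iff : rel_zero_regular f K Kx I <-> bounded_set Kx.
Proof.
split=> [[_ [lam [_ _ lamI]]]|Kb].
  move=> /bounded_of_cone_subset; apply=> v vcone; split=> // w wcone.
  have bnd := combination_bounded lamI.
  by rewrite !(asym_poly_bounded bnd).
split; first exact: section_admissible.
have inI i : (\row_j (j \in I)%:R : 'rV[R]_q) 0 i != 0 = (i \in I).
  by rewrite mxE pnatr_eq0 eqb0 negbK.
exists (\row_i (i \in I)%:R); split.
- by move=> i; rewrite mxE.
- have /finset.set0Pn[i iI] := I0; apply/eqP => /rowP/(_ i)/eqP.
  by apply/negP; rewrite [X in _ == X]mxE inI.
- by apply/finset.setP => i; rewrite finset.inE inI.
- by apply: bounded_subset_cone => // v [].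
Qed.

(** For [i] in [I] the [i]-th component of [asym_vec f] vanishes on the cone, so no
    point of the cone is improved in all components. *)
Lemma strongly_regular_iff : rel_strongly_regular f K Kx <-> bounded_set Kx.
Proof.
have /finset.set0Pn[i iI] := I0.
split=> [[_ /bounded_of_cone_subset]|Kb].
  apply=> v vcone; split=> // w wcone [c cint /rowP/(_ i)].
  have := interior_orthant_gt0 i cint.
  by rewrite [in RHS]mxE [X in _ = _ + X]mxE !asym_vec0// mxE; lra.
split; first exact: section_admissible.
by apply: bounded_subset_cone => // v [].
Qed.

(** When [I] is the whole index set, [asym_vec f] vanishes on the cone and every
    point of the cone is efficient. *)
Lemma bounded_of_weakly_regular : I = finset.setT ->
  rel_weakly_regular f K Kx -> bounded_set Kx.
Proof.
move=> IT [_ /bounded_of_cone_subset]; apply=> v vcone; split=> // w wcone.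
have av0 x : asym_cone Kx x -> asym_vec f x = 0.
  by move=> xcone; apply/rowP => i; rewrite asym_vec0 ?IT ?finset.inE// [RHS]mxE.
move=> [c [_ cn0]]; rewrite !av0// subrr => /eqP.
by rewrite oppr_eq0 => /eqP.
Qed.

Lemma section_image_bounded : bounded_set [set vval_on f I z | z in Kx].
Proof.
have exM (j : 'I_#|I|) : exists M : R, forall z, Kx z ->
    `|peval (f (enum_val j)) z| <= M.
  exact: section_values_bounded (enum_valP j).
have [M MP] := choice exM.
apply/bounded_setP; exists (\sum_j `|M j|) => _ [z Kz <-].
apply: norm_le_coords => [|j]; first exact: sumr_ge0.
rewrite mxE (le_trans (MP j z Kz))// (le_trans (ler_norm _))//.
by rewrite (bigD1 j)//= lerDl sumr_ge0.
Qed.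

(** Since [f_I] is bounded on the section, properness says that no sequence of the
    section goes to infinity. *)
Lemma proper_iff : proper_at f K I (vval f xbar) <-> bounded_set Kx.
Proof.
split=> [prop|Kb x Kx' xoo fx]; last first.
  by exfalso; apply: (bounded_no_escape Kb _ xoo) => k; split.
apply: contrapT => Kunb.
have ex (k : nat) : exists x, Kx x /\ k%:R <= enorm x.
  by have [x] := unbounded_enorm k%:R Kunb; exists x.
have [x xP] := choice ex.
have Kxx k : Kx (x k) := (xP k).1.
have xoo : enorm (x k) @[k --> \oo] --> +oo.
  apply/cvgryPge => A; have : \forall k \near \oo, A <= k%:R by exact: nbhs_infty_ger.
  by apply: filterS => k Ak; exact: le_trans Ak (xP k).2.
have := prop x (fun k => (Kxx k).1) xoo (fun k => (Kxx k).2).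
by apply: (bounded_no_escape section_image_bounded) => k; exists (x k).
Qed.

(** On the section the values of [f_I] stay in a compact set, so any points of
    the section going to infinity yield an asymptotic value. *)
Lemma escaping_subseq (A : set 'rV[R]_n) (P : nat -> 'rV[R]_n -> Prop) :
  (forall k : nat, exists x, [/\ Kx x, k%:R <= enorm x, A x & P k x]) ->
  exists (x : nat -> 'rV[R]_n) (y : 'rV[R]_#|I|),
    escaping f A y0 x y /\ forall k, exists2 j, (k <= j)%N & P j (x k).
Proof.
move=> ex; have [x xP] := choice ex.
have [M MP] := (bounded_setP _).1 section_image_bounded.
have Cv k : ([set: 'rV[R]_#|I|] `&` [set y | `|0 - y| <= M]) (vval_on f I (x k)).
  have [Kxx _ _ _] := xP k; split=> //=; rewrite sub0r normrN.
  by apply: MP; exists (x k).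
have [phi [y [_ phi_ge limy]]] := 
  compact_subseq (@compact_closed_ball R _ setT 0 M closedT) Cv.
exists (x \o phi), y; split; first split=> //.
- by move=> k; have [] := xP (phi k).
- by move=> k; have [Kxx _ _ _] := xP (phi k); exact: section_vle_ext Kxx.
- apply/cvgryPge => a; have : \forall k \near \oo, a <= k%:R by exact: nbhs_infty_ger.
  apply: filterS => k ak; have [_ xk _ _] := xP (phi k).
  by rewrite (le_trans ak)// (le_trans _ xk)// ler_nat.
- by move=> k; exists (phi k) => //; have [] := xP (phi k).
Qed.

Lemma escaping_unbounded (A : set 'rV[R]_n) x (y : 'rV[R]_#|I|) :
  A `<=` K -> escaping f A y0 x y -> ~ bounded_set Kx.
Proof.
move=> AK [Ax fx xoo _] Kb; apply: (bounded_no_escape Kb _ xoo) => k.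
by apply: vle_ext_section => //; exact: AK.
Qed.

Lemma palais_smale_of_bounded : bounded_set Kx -> palais_smale f K I y0.
Proof.
move=> Kb; apply/seteqP; split=> // y [x [esc _]].
exact: (escaping_unbounded (fun=> id) esc).
Qed.

Lemma weak_of_palais_smale :
  palais_smale f K I y0 -> weak_palais_smale f K I y0.
Proof.
move=> ps; apply/seteqP; split=> // y [x [esc nux]]; rewrite -ps.
exists x; split=> //; have [_ _ xoo _] := esc.
apply: (squeeze_cvgr _ (cvg_cst (0 : R)) nux).
move/cvgryPge: xoo => /(_ 1); apply: filterS => k xk.
by rewrite rabier_ge0 ler_peMl// rabier_ge0.
Qed.

Lemma bounded_of_weak_palais_smale :
  weak_palais_smale f K I y0 -> bounded_set Kx.
Proof.
move=> wps; apply: contrapT => Kunb.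
have /finset.set0Pn[i iI] := I0; have [m mP] := section_value_bounds iI.
have [|x [y [esc xP]]] := @escaping_subseq K
    (fun k x => enorm x * rabier f K x <= k.+1%:R^-1).
  move=> k; have k0 : 0 < k.+1%:R^-1 :> R by rewrite invr_gt0.
  have [x [Kxx kx nux]] := small_rabier_at_infinity k%:R Kclosed Kunb mP k0.
  by exists x; split=> //; have [] := Kxx.
have : weak_PS_values f K y0 y.
  exists x; split=> //.
  apply: (squeeze_cvgr _ (cvg_cst (0 : R)) (@cvg_harmonic R)).
  apply: nearW => k; rewrite mulr_ge0 ?enorm_ge0 ?rabier_ge0//=.
  have [j kj] := xP k; move/le_trans; apply.
  by rewrite /harmonic lef_pV2 ?posrE// ler_nat.
by rewrite wps.
Qed.

Lemma M_tame_iff : M_tame f K I y0 <-> bounded_set Kx.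
Proof.
split=> [tame|Kb]; last first.
  apply/seteqP; split=> // y [x esc].
  by apply: (escaping_unbounded _ esc) => // z [].
apply: contrapT => Kunb; have /finset.set0Pn[i _] := I0.
have [|x [y [esc _]]] := @escaping_subseq (tangency_variety f K) (fun _ _ => True).
  move=> k; have [x [Kxx kx xG]] := tangency_at_infinity i k%:R Kclosed Kunb.
  by exists x.
have : tangency_values f K y0 y by exists x.
by rewrite tame.
Qed.

End Equivalences.

Theorem corollary17 (R : realType) (n q : nat) (K : set 'rV[R]_n)
    (f : 'I_q -> mpoly.mpoly n R) (xbar : 'rV[R]_n) (I : {set 'I_q})
    (K0 : K !=set0) (Kunbounded : ~ bounded_set K) (Kclosed : closed K)
    (fdeg : forall i, (1 <= pdeg (f i))%N)
    (Kxbar : K xbar) (I0 : I != finset.set0)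
    (fbound : section_bounded_below f K I xbar) :
  let Kx := section f K xbar in
  let y0 := ext_level (vval f xbar) in
  [/\ [<-> rel_zero_regular f K Kx I;
           rel_strongly_regular f K Kx;
           proper_at f K I (vval f xbar);
           palais_smale f K I y0;
           weak_palais_smale f K I y0;
           M_tame f K I y0],
      rel_zero_regular f K Kx I \/ rel_strongly_regular f K Kx \/
      proper_at f K I (vval f xbar) \/ palais_smale f K I y0 \/
      weak_palais_smale f K I y0 \/ M_tame f K I y0 ->
        SOLs K (vval f) !=set0
    & I = finset.setT -> rel_weakly_regular f K Kx ->
        SOLs K (vval f) !=set0].
Proof.
move=> Kx y0.
have zr := zero_regular_iff Kclosed Kxbar I0 fbound.
have sr := strongly_regular_iff Kclosed Kxbar fdeg I0 fbound.
have pr := proper_iff fbound.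
have mt := M_tame_iff Kclosed I0 fbound.
have b_ps := @palais_smale_of_bounded R n q K f xbar I.
have ps_wps := @weak_of_palais_smale R n q K f xbar I.
have wps_b := bounded_of_weak_palais_smale Kclosed I0 fbound.
have pareto := pareto_of_bounded Kclosed Kxbar.
rewrite -/Kx -/y0 in zr sr pr mt b_ps ps_wps wps_b pareto; split.
- tfae.
  + by move=> /zr/sr.
  + by move=> /sr/pr.
  + by move=> /pr/b_ps.
  + exact: ps_wps.
  + by move=> /wps_b/mt.
  + by move=> /mt/zr.
- move=> any; apply: pareto.
  by case: any => [/zr|[/sr|[/pr|[/ps_wps/wps_b|[/wps_b|/mt]]]]].
- move=> IT wr; apply: pareto.
  exact: (bounded_of_weakly_regular fdeg fbound IT wr).
Qed.
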